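(* Let $\mathcal{A}=\mathbb{C}[x]$ with $x^*=x$, let $m\in\mathbb{N}$ and $\lambda>0$, and let $(\phi^N)_{N\in\mathbb{N}}$ be a sequence of states on $\mathcal{A}$ such that $\lim_{N\to\infty}N\phi^N(x^k)=\lambda$ for every $k\in\mathbb{N}$. Let $S_{m,N}=\sum_{k=1}^N j_k^{(m)}(x)$ and denote by $\widetilde\Phi^{(m,N)}$ the $m$-free product state corresponding to $\phi^N$. Then for every $n\in\mathbb{N}$ $$\lim_{N\to\infty}\widetilde\Phi^{(m,N)}\left(S_{m,N}^n\right)=\sum_{q=1}^n\lambda^q\,|NC_n(q,m)|.$$
   Context: $\mathbb{N}=\{1,2,\ldots\}$. A state on a unital complex $*$-algebra is a linear functional $\phi$ with $\phi(\mathbf{1})=1$ and $\phi(x^*x)\ge 0$. Construction of $j_l^{(m)}$ and the $m$-free product state. Let the index set be $I=\mathbb{N}$; for each $l\in I$ let $\mathcal{A}_l=\mathcal{A}=\mathbb{C}[x]=\mathcal{A}_l^0\oplus\mathbb{C}\mathbf{1}_l$, where $\mathcal{A}_l^0$ is the set of polynomials without constant term, and let $\phi_l=\phi^N$. Let $\widetilde{\mathcal{A}}_l=\mathcal{A}_l*\mathbb{C}(t_l)$ be the free product (units identified) of $\mathcal{A}_l$ with the unital $*$-algebra generated by a single projection $t_l=t_l^*=t_l^2$. Let $\widetilde\phi_l$ be the Boolean extension of $\phi_l$, i.e. the state on $\widetilde{\mathcal{A}}_l$ given by $\widetilde\phi_l(\mathbf{1}_l)=1$, $\widetilde\phi_l(t_l)=1$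 and $\widetilde\phi_l(t_l^{r}a^{(1)}t_l a^{(2)}t_l\cdots t_l a^{(p)}t_l^{s})=\phi_l(a^{(1)})\cdots\phi_l(a^{(p)})$ for $a^{(1)},\ldots,a^{(p)}\in\mathcal{A}_l^0$, $r,s\in\{0,1\}$. Let $\mathcal{B}=\bigotimes_{l\in I}\widetilde{\mathcal{A}}_l^{\otimes\infty}$ be the $*$-algebra spanned by simple tensors $\bigotimes_{(l,k)\in I\times\mathbb{N}}x_{l,k}$ with $x_{l,k}\in\widetilde{\mathcal{A}}_l$ and all but finitely many $x_{l,k}\in\{\mathbf{1}_l,t_l\}$ (sitewise product and involution), with the product state $\widetilde\Phi(\bigotimes x_{l,k})=\prod_{l,k}\widetilde\phi_l(x_{l,k})$. For $a\in\mathcal{A}_l^0$, $k\in\mathbb{N}$: $\gamma_k^{(l)}(a)\in\mathcal{B}$ is the simple tensor with $a$ at site $(l,k)$, $t_r$ at every site $(r,s)$ with $r\neq l$, $s\ge k$, and units elsewhere; $\widehat\gamma_k^{(l)}(a)$ for $k\geq 2$ is the simple tensor with $a$ at site $(l,k)$, $t_r$ at every site $(r,s)$ with $r\ne l$, $s\ge k-1$, and units elsewhere; $\widehat\gamma_1^{(l)}(a)=0$. Put $j_{l,k}=\gamma_k^{(l)}-\widehat\gamma_k^{(l)}$ and $j_l^{(m)}=\sum_{k=1}^m j_{l,k}:\mathcal{A}_l^0\to\mathcal{B}$ (a $*$-homomorphism). The $m$-free product state $\widetilde\Phi^{(m,N)}$ is the restriction of $\widetilde\Phi$ (built from $\phi_l=\phi^N$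 for all $l$) to the $*$-algebra generated by the unit of $\mathcal{B}$ and all $j_l^{(m)}(\mathcal{A}_l^0)$, $l\in I$. Partitions. A partition of $\{1,\ldots,n\}$ is non-crossing if there are no $i<j<i'<j'$ with $i,i'$ in one block and $j,j'$ in a different block. The depth of a non-crossing partition is the maximal $d$ for which there are blocks $B_1,\ldots,B_d$ with $\min B_i<\min B_{i+1}\le\max B_{i+1}<\max B_i$ for $1\le i<d$. $|NC_n(q,m)|$ is the number of non-crossing partitions of $\{1,\ldots,n\}$ with $q$ blocks and depth at most $m$. *)

(* Defs.v *)
From HB Require Import structures.
From mathcomp Require Import all_boot all_order all_algebra finmap complex.
(* [monalg] has to be imported before the analysis files: in the other order
   the declared levels of their notations clash. *)
From mathcomp Require Import monalg.
From mathcomp Require Import boolp classical_sets cardinality fsbigop.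
From mathcomp Require Import reals topology normedtype.

Set Implicit Arguments.
Unset Strict Implicit.
Unset Printing Implicit Defensive.

Import Order.TTheory GRing.Theory Num.Theory.
Import numFieldNormedType.Exports.

Local Open Scope ring_scope.
Local Open Scope complex_scope.

(* The involution of C[x] for which x^* = x. *)
Definition poly_star (R : realType) (p : {poly R[i]}) : {poly R[i]} :=
  map_poly (fun c => c^*) p.

(* In [R[i]], [0 <= z] means that z is real and nonnegative. *)
Definition is_state (R : realType) (phi : {scalar {poly R[i]}}) : Prop :=
  phi 1 = 1 /\ forall p, 0 <= phi (poly_star p * p).

(* The free product of C[x] with the algebra generated by a projection t is the
   monoid algebra of the monoid <x, t | t^2 = t>, whose elements are the words
   in x and t without two consecutive t's.  In a word, [true] stands for t and
   [false] for x. *)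
Definition reduced : pred (seq bool) := sorted (fun a b => ~~ (a && b)).

Record word := Word { word_seq :> seq bool; word_reduced : reduced word_seq }.

HB.instance Definition _ := [isSub for word_seq].
HB.instance Definition _ := [Choice of word by <:].

Definition cons_letter (b : bool) (s : seq bool) : seq bool :=
  if b && head false s then s else b :: s.

Definition rcat (s1 s2 : seq bool) : seq bool := foldr cons_letter s2 s1.

Lemma cons_letter_reduced b s : reduced s -> reduced (cons_letter b s).
Proof.
by rewrite /cons_letter /reduced; case: b s => [] [|[] s] //= ->.
Qed.

Lemma rcat_reduced s1 s2 : reduced s2 -> reduced (rcat s1 s2).
Proof. by move=> h; elim: s1 => //= b s; apply: cons_letter_reduced. Qed.

Lemma rcatA : associative rcat.
Proof.
move=> s1 s2 s3; elim: s1 => //= b s ->.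
set u := rcat s s2; rewrite {2}/cons_letter; case: ifP => // /andP[-> {b}].
by case: u => [|[] u] //= _; rewrite /cons_letter; case: (rcat u s3) => [|[]].
Qed.

Lemma rcats0 s : reduced s -> rcat s [::] = s.
Proof.
elim: s => //= b s IH h; rewrite IH; last by rewrite /reduced (path_sorted h).
by rewrite /cons_letter; case: b s h {IH} => [] [|[] s] .
Qed.

Lemma cons_letter_neq0 b s : cons_letter b s <> [::].
Proof. by rewrite /cons_letter; case: b s => [] [|[]]. Qed.

Definition word1 : word := @Word [::] isT.
Definition wordM (w1 w2 : word) : word :=
  Word (rcat_reduced w1 (word_reduced w2)).

Lemma wordMA : associative wordM.
Proof. by move=> w1 w2 w3; apply: val_inj; apply: rcatA. Qed.

Lemma word1M : left_id word1 wordM.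
Proof. by move=> w; apply: val_inj. Qed.

Lemma wordM1 : right_id word1 wordM.
Proof. by move=> w; apply: val_inj; apply/rcats0/word_reduced. Qed.

Lemma word_unitM w1 w2 : wordM w1 w2 = word1 -> w1 = word1 /\ w2 = word1.
Proof.
case: w1 w2 => [[|b s] h1] [s2 h2] /(congr1 val) /=.
  by move=> e; split; apply: val_inj.
by move/cons_letter_neq0.
Qed.

HB.instance Definition _ :=
  Choice_isMonomialDef.Build word wordMA word1M wordM1 word_unitM.

Notation Atilde R := {malg R[i][word]}.

Lemma xpow_reduced k : reduced (nseq k false).
Proof. by rewrite /reduced; elim: k => //= -[]. Qed.

Definition xpow (k : nat) : word := Word (xpow_reduced k).
Definition wt : word := @Word [:: true] isT.

Definition incl (R : realType) (a : {poly R[i]}) : Atilde R :=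
  \sum_(k < size a) << a`_k *g xpow k >>.

(* [runs] of x^k0 t x^k1 t ... t x^kr is [:: k0; k1; ...; kr]; only k0 and kr
   may be 0 in a reduced word. *)
Fixpoint runs (s : seq bool) : seq nat :=
  match s with
  | [::] => [:: 0%N]
  | true :: s' => 0%N :: runs s'
  | false :: s' => incr_nth (runs s') 0
  end.

Definition word_value (R : realType) (phi : {scalar {poly R[i]}}) (w : word)
    : R[i] :=
  \prod_(k <- runs w | (0 < k)%N) phi 'X^k.

Definition boolean_ext (R : realType) (phi : {scalar {poly R[i]}})
    : Atilde R -> R[i] :=
  mmap idfun (word_value phi).

(* A site (l, k) carries the k-th copy of the l-th algebra.  Both indices range
   over {1, 2, ...} on paper and are shifted here so as to start at 0. *)
Definition site : Type := (nat * nat)%type.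

(* The simple tensors of words, all but finitely many of which are 1 or t,
   form a basis that is closed under the (sitewise) product: the tensor product
   is the monoid algebra of the monoid [tword]. *)
Definition almost_1t (f : site -> word) : bool :=
  `[< finite_set [set s | ~ (f s = word1 \/ f s = wt)]%classic >].

Record tword :=
  TWord { tword_fun :> site -> word; tword_almost : almost_1t tword_fun }.

HB.instance Definition _ := [isSub for tword_fun].
HB.instance Definition _ := [Choice of tword by <:].

Lemma finite_almost_1t (f : site -> word) (A : set site) :
  finite_set A -> (forall s, ~ A s -> f s = word1 \/ f s = wt) -> almost_1t f.
Proof.
move=> finA h; apply/asboolP; apply: sub_finite_set finA => s /= hs.
by apply: contrapT => /h.
Qed.

Lemma tword1_almost : almost_1t (fun=> word1).
Proof. by apply: (finite_almost_1t (finite_set0 _)) => s _; left. Qed.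

Lemma wordMtt : wordM wt wt = wt.
Proof. exact: val_inj. Qed.

Lemma twordM_almost (f g : tword) : almost_1t (fun s => wordM (f s) (g s)).
Proof.
have /asboolP hf := tword_almost f; have /asboolP hg := tword_almost g.
have fg : finite_set ([set s | ~ (f s = word1 \/ f s = wt)] `|`
    [set s | ~ (g s = word1 \/ g s = wt)])%classic by rewrite finite_setU.
apply: (finite_almost_1t fg) => s /= /not_orP[/contrapT hfs /contrapT hgs].
by case: hfs hgs => -> [] ->; rewrite ?word1M ?wordM1 ?wordMtt; tauto.
Qed.

Definition tword1 : tword := TWord tword1_almost.
Definition twordM (f g : tword) : tword := TWord (twordM_almost f g).

Lemma twordMA : associative twordM.
Proof.
by move=> f g h; apply: val_inj; apply: funext => s; apply: wordMA.
Qed.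

Lemma tword1M : left_id tword1 twordM.
Proof. by move=> f; apply: val_inj; apply: funext => s; apply: word1M. Qed.

Lemma twordM1 : right_id tword1 twordM.
Proof. by move=> f; apply: val_inj; apply: funext => s; apply: wordM1. Qed.

Lemma tword_unitM f g : twordM f g = tword1 -> f = tword1 /\ g = tword1.
Proof.
move/(congr1 val) => fg; have h s : f s = word1 /\ g s = word1.
  by apply: word_unitM; have := congr1 (@^~ s) fg.
by split; apply: val_inj; apply: funext => s; case: (h s).
Qed.

HB.instance Definition _ :=
  Choice_isMonomialDef.Build tword twordMA tword1M twordM1 tword_unitM.

Notation Btensor R := {malg R[i][tword]}.

(* Product of the values at all sites; [word_value phi] is 1 at 1 and at t, so
   that only finitely many factors differ from 1. *)
Definition tword_value (R : realType) (phi : {scalar {poly R[i]}}) (f : tword)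
    : R[i] :=
  \big[*%R/1]_(s \in [set: site]%classic) word_value phi (f s).

Definition product_state (R : realType) (phi : {scalar {poly R[i]}})
    : Btensor R -> R[i] :=
  mmap idfun (tword_value phi).

Lemma single_almost (s : site) (w : word) :
  almost_1t (fun s' => if s' == s then w else word1).
Proof.
apply: (finite_almost_1t (finite_set1 s)) => s' /= /eqP/negbTE ->.
by left.
Qed.

Lemma tset_almost (P : pred site) :
  almost_1t (fun s => if P s then wt else word1).
Proof. by apply: (finite_almost_1t (finite_set0 _)) => s _; case: ifP; tauto. Qed.

Definition single (s : site) (w : word) : tword := TWord (single_almost s w).
Definition tset (P : pred site) : tword := TWord (tset_almost P).

(* The simple tensor with y at the site s and units elsewhere. *)
Definition at_site (R : realType) (s : site) (y : Atilde R) : Btensor R :=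
  \sum_(w <- msupp y) << y@_w *g single s w >>.

(* The simple tensor with t at the sites in P and units elsewhere. *)
Definition t_on (R : realType) (P : pred site) : Btensor R := << tset P >>.

Definition gamma (R : realType) (l k : nat) (a : {poly R[i]}) : Btensor R :=
  at_site (l, k) (incl a) * t_on R (fun s => (s.1 != l) && (k <= s.2)%N).

Definition gamma_hat (R : realType) (l k : nat) (a : {poly R[i]})
    : Btensor R :=
  if k is k'.+1 then
    at_site (l, k) (incl a) * t_on R (fun s => (s.1 != l) && (k' <= s.2)%N)
  else 0.

Definition j_site (R : realType) (l k : nat) (a : {poly R[i]}) : Btensor R :=
  gamma l k a - gamma_hat l k a.

(* Meant for polynomials [a] without constant term. *)
Definition j_hom (R : realType) (m l : nat) (a : {poly R[i]}) : Btensor R :=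
  \sum_(k < m) j_site l k a.

(* The m-free product state is the restriction of [product_state] to the
   *-subalgebra generated by 1 and the images of the [j_hom m l] on polynomials
   without constant term.  The powers of [S_sum m N] lie in this subalgebra, and
   the restriction takes the same value at them. *)
Definition S_sum (R : realType) (m N : nat) : Btensor R :=
  \sum_(l < N) j_hom m l 'X.

Definition noncrossing (n : nat) (P : {set {set 'I_n}}) : bool :=
  [forall B in P, forall B' in P, (B != B') ==>
    ~~ [exists i in B, exists j in B', exists i' in B, exists j' in B',
        [&& i < j, j < i' & i' < j']%N]].

(* Applied to nonempty blocks, for which the neutral element [n] is harmless. *)
Definition bmin (n : nat) (B : {set 'I_n}) : nat :=
  \big[minn/n]_(i in B) (i : nat).
Definition bmax (n : nat) (B : {set 'I_n}) : nat := \max_(i in B) (i : nat).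

Definition nested (n : nat) (B B' : {set 'I_n}) : bool :=
  [&& bmin B < bmin B', bmin B' <= bmax B' & bmax B' < bmax B]%N.

(* The minima along a chain of nested blocks increase strictly, so that a chain
   has at most n blocks. *)
Definition depth (n : nat) (P : {set {set 'I_n}}) : nat :=
  \max_(d < n.+1 | [exists s : d.-tuple {set 'I_n},
                      all [in P] s && sorted (@nested n) s]) d.

Definition NC (n q m : nat) : {set {set {set 'I_n}}} :=
  [set P : {set {set 'I_n}} | [&& finset.partition P [set: 'I_n], noncrossing P, #|P| == q
             & (depth P <= m)%N]].

Section Agreement.

Variables (R : realType) (phi : {scalar {poly R[i]}}).

Let T : Atilde R := << wt >>.

Lemma word_value_tM w : word_value phi (wordM wt w) = word_value phi w.
Proof.
rewrite /word_value /= /cons_letter /=; case: w => -[|[] s] h //=;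
by rewrite ?big_cons.
Qed.

Lemma runs_xpow k : runs (xpow k) = [:: k].
Proof. by elim: k => //= k /= ->. Qed.

Lemma runs_xtM k w :
  runs (wordM (xpow k.+1) (wordM wt w)) = k.+1 :: behead (runs (wordM wt w)).
Proof.
have e : exists s, val (wordM wt w) = true :: s.
  by rewrite /= /cons_letter; case: (val w) => [|[] s]; eexists.
case: e => s /= ->.
elim: k => [|k]; first by rewrite /= /cons_letter.
by rewrite /= /cons_letter /= => ->.
Qed.

Lemma word_value_xtM k w : word_value phi (wordM (xpow k.+1) (wordM wt w)) =
  phi 'X^(k.+1) * word_value phi w.
Proof.
rewrite -[in RHS]word_value_tM /word_value runs_xtM big_cons /=; congr (_ * _).
by rewrite /cons_letter; case: (word_seq w) => [|[] s] /=; rewrite [RHS]big_cons.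
Qed.

Lemma boolean_ext1 : boolean_ext phi 1 = 1.
Proof.
rewrite /boolean_ext mmapU /= mul1r /word_value /=.
by rewrite big_cons big_nil.
Qed.

Lemma boolean_ext_tM z : boolean_ext phi (T * z) = boolean_ext phi z.
Proof.
rewrite [z in LHS]monalgE mulr_sumr /boolean_ext raddf_sum mmapE.
apply: eq_bigr => w _.
by rewrite malgM_def fgmulUU /= mmapU mul1r word_value_tM.
Qed.

Lemma phi_no_constant (a : {poly R[i]}) : a`_0 = 0 ->
  phi a = \sum_(k < size a | (0 < k)%N) a`_k * phi 'X^k.
Proof.
move=> a0; rewrite -[in LHS](coefK a) poly_def linear_sum [LHS]/=.
rewrite (bigID (fun k : 'I__ => (0 < k)%N)) /= addrC big1 ?add0r.
  by apply: eq_bigr => k _; rewrite linearZ.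
by move=> [[|k] h] //= _; rewrite a0 scale0r linear0.
Qed.

Lemma boolean_ext_inclM (a : {poly R[i]}) z : a`_0 = 0 ->
  boolean_ext phi (incl a * T * z) = phi a * boolean_ext phi z.
Proof.
move=> a0; rewrite phi_no_constant // -mulrA /boolean_ext /incl [in LHS]mulr_suml mulr_suml.
rewrite (raddf_sum (mmap idfun (word_value phi))).
rewrite (bigID (fun k : 'I__ => (0 < k)%N)) /= addrC big1 ?add0r; last first.
  by move=> [[|k] h] //= _; rewrite a0 monalgU0 mul0r raddf0.
apply: eq_bigr => -[[|k] h] //= _.
have -> : << a`_k.+1 *g xpow k.+1 >> * (T * z) =
    \sum_(w <- msupp z) << a`_k.+1 * z@_w *g mmul (mmul (xpow k.+1) wt) w >>.
  by rewrite mulrA -fgmulUg -[a`_k.+1 in RHS]mulr1 -fgmulUU.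
rewrite (raddf_sum (mmap idfun (word_value phi))) [mmap _ _ z]mmapE mulr_sumr.
apply: eq_bigr => w _; rewrite /= mmapU -mulmA word_value_xtM /=.
by rewrite mulrACA.
Qed.

Lemma boolean_ext_incl (a : {poly R[i]}) :
  a`_0 = 0 -> boolean_ext phi (incl a) = phi a.
Proof.
move=> a0; rewrite phi_no_constant // /incl /boolean_ext raddf_sum.
rewrite (bigID (fun k : 'I__ => (0 < k)%N)) /= addrC big1 ?add0r; last first.
  by move=> [[|k] h] //= _; rewrite a0 monalgU0 raddf0.
apply: eq_bigr => -[[|k] h] //= _.
by rewrite /= mmapU /word_value runs_xpow big_cons big_nil /= mulr1.
Qed.

Lemma boolean_ext_exprM u v w (r : bool) :
  boolean_ext phi (T ^+ r * u * v * w) = boolean_ext phi (u * (v * w)).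
Proof.
have assoc (A : nzRingType) (a b c d : A) : a * b * c * d = a * (b * (c * d)).
  by rewrite !mulrA.
rewrite assoc; case: r; first by rewrite expr1; exact: boolean_ext_tM.
by rewrite expr0 mul1r.
Qed.

(* phi~(t^r a1 t a2 t ... t ap t^s) = phi(a1) ... phi(ap) *)
Lemma boolean_extE (r s : bool) (l : seq {poly R[i]}) (a : {poly R[i]}) :
  all (fun b : {poly R[i]} => b`_0 == 0) (rcons l a) ->
  boolean_ext phi
    (T ^+ r * (\prod_(b <- l) (incl b * T)) * incl a * T ^+ s) =
  \prod_(b <- rcons l a) phi b.
Proof.
rewrite boolean_ext_exprM; elim: l => [/=|b l IH /= /andP[/eqP b0 /IH h]].
  rewrite andbT big_nil big_seq1 mul1r => /eqP a0; case: s.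
    rewrite expr1 -[X in boolean_ext _ X]mulr1 boolean_ext_inclM //.
    by rewrite boolean_ext1 mulr1.
  by rewrite expr0 mulr1 boolean_ext_incl.
by rewrite big_cons -mulrA boolean_ext_inclM // h big_cons.
Qed.

Lemma word_value1 : word_value phi word1 = 1.
Proof. by rewrite /word_value /= big_cons big_nil. Qed.

Lemma word_valuet : word_value phi wt = 1.
Proof. by rewrite /word_value /= !big_cons big_nil. Qed.

Lemma tword_value_seq (f : tword) (r : seq site) : uniq r ->
  (forall s, s \notin r -> f s = word1 \/ f s = wt) ->
  tword_value phi f = \prod_(s <- r) word_value phi (f s).
Proof.
move=> ur fr; rewrite /tword_value (fsbigE r) //; last first.
  by move=> s _ /fr[] ->; rewrite ?word_value1 ?word_valuet.
by apply: eq_bigl => s; apply/mem_set.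
Qed.

Lemma tword_value_singleM s w (g : tword) : g s = word1 ->
  tword_value phi (twordM (single s w) g) = word_value phi w * tword_value phi g.
Proof.
move=> gs; have /asboolP gfin := tword_almost g.
have Afin := conj gfin (finite_set1 s); rewrite -finite_setU in Afin.
set A := (_ `|` _)%classic in Afin.
have gA s' : s' \notin fset_set A -> g s' = word1 \/ g s' = wt.
  by move=> s'A; apply: contrapT => h; case/negP: s'A; rewrite in_fset_set //; apply/mem_set; left.
have sA : s \in fset_set A by rewrite in_fset_set //; apply/mem_set; right.
rewrite !(@tword_value_seq _ (fset_set A)) ?fset_uniq //; last first.
  move=> s' s'A; rewrite /=; case: eqP => [e|_]; last by rewrite word1M; apply: gA.
  by rewrite e sA in s'A.
rewrite !(bigD1_seq s) ?fset_uniq //= eqxx gs wordM1 word_value1 mul1r.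
congr (_ * _); apply: eq_bigr => s' /negbTE ->.
by rewrite word1M.
Qed.

Lemma product_stateMU z (c : R[i]) g :
  product_state phi (z * << c *g g >>) = c * product_state phi (z * << g >>).
Proof.
have E (d : R[i]) : z * << d *g g >> =
    \sum_(f <- msupp z) << z@_f * d *g mmul f g >> by exact: fgmulgU.
rewrite !E /product_state !(raddf_sum (mmap idfun (tword_value phi))) mulr_sumr.
apply: eq_bigr => f _; rewrite /= !mmapU /= mulr1 mulrA; congr (_ * _).
exact: mulrC.
Qed.

(* Phi~ is the product of the values phi~(x_s) on the simple tensor with
   entries x_s at the sites of l, t at the sites of P and units elsewhere. *)
Lemma product_stateE (l : seq site) (x : site -> Atilde R) (P : pred site) :
  uniq l -> ~~ has P l ->
  product_state phi ((\prod_(s <- l) at_site s (x s)) * t_on R P) =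
  \prod_(s <- l) boolean_ext phi (x s).
Proof.
move=> ul Pl; rewrite /t_on.
have -> : \prod_(s <- l) boolean_ext phi (x s) =
    (\prod_(s <- l) boolean_ext phi (x s)) * tword_value phi (tset P).
  rewrite /tword_value fsbig1 ?mulr1 // => s _ /=.
  by case: ifP; rewrite ?word_value1 ?word_valuet.
have : forall s, s \in l -> tset P s = word1.
  by move=> s sl; rewrite /= (negbTE (hasPn Pl s sl)).
elim/last_ind: l ul (tset P) {Pl} => [_ g _|l s IH].
  by rewrite !big_nil !mul1r /product_state mmapU mul1r.
rewrite rcons_uniq => /andP[sl ul] g gP.
have E : at_site s (x s) * << g >> =
    \sum_(w <- msupp (x s)) << (x s)@_w *g mmul (single s w) g >>.
  rewrite /at_site mulr_suml; apply: eq_bigr => w _.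
  by rewrite malgM_def fgmulUU mulr1.
rewrite !big_rcons /= -mulrA E mulr_sumr /product_state.
rewrite (raddf_sum (mmap idfun (tword_value phi))).
rewrite -mulrA [boolean_ext _ _ * _]mulr_suml mulr_sumr.
apply: eq_bigr => w _.
rewrite /= -/(product_state phi _) product_stateMU IH //; last first.
  move=> s' s'l; rewrite /= gP ?wordM1 ?mem_rcons ?inE ?s'l ?orbT //.
  by case: eqP => // e; rewrite -e s'l in sl.
rewrite tword_value_singleM; last by rewrite gP // mem_rcons mem_head.
by rewrite mulrCA; congr (_ * _); rewrite mulrA.
Qed.

End Agreement.

(* Main.v *)
(* Expanding S^n, one term for each labelling l of {1..n} by algebras, each
   choice of colors k_i (the copy of the algebra) and each choice between gamma
   and gamma_hat, gives simple tensors of words.  At the site (a, k) the word has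
   an x for every i with l_i = a, k_i = k and a t for every i with l_i <> a whose
   color is small enough, so its value is a product of moments of phi^N, one for
   every maximal run of x's.  Each moment is asymptotic to lambda / N, and a
   partition P of {1..n} is the kernel of N (N-1) ... (N-|P|+1) labellings; hence
   only the terms with exactly one run for each block survive.  This happens iff
   the color is constant on blocks and each letter j has a color (lowered by one
   for gamma_hat) greater than the colors of all blocks that cover j.  The signed
   sum over gamma and gamma_hat turns this into "k_j is one more than the maximal
   color of the blocks covering j", with lowest color 0.  Such a coloring exists
   iff P is non-crossing of depth at most m; it is then unique, the color of a
   block being its nesting level. *)

Require Import Defs.
From mathcomp Require Import all_boot all_order all_algebra finmap complex.
From mathcomp Require Import monalg.
From mathcomp Require Import boolp classical_sets.
From mathcomp Require Import reals topology normedtype.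
(* Last, so that [partition], [pblock], ... are not those of [classical_sets]. *)
From mathcomp Require Import finset.

Set Implicit Arguments.
Unset Strict Implicit.
Unset Printing Implicit Defensive.

Import Order.TTheory GRing.Theory Num.Theory.
Import numFieldNormedType.Exports.

(** * Nesting levels of non-crossing partitions *)

Section Levels.

Variables (n : nat) (P : {set {set 'I_n}}).
Hypothesis P_part : partition P [set: 'I_n].

(** A relation between positions rather than blocks, so that it makes sense for crossing partitions
    too, where it may change inside a block. For a non-crossing [P] it amounts to nesting of
    blocks. *)
Definition covers (i j : 'I_n) : bool :=
  [&& i < j, pblock P i != pblock P j
    & [exists k : 'I_n, (j < k) && (pblock P k == pblock P i)]]%N.

Let tiP : trivIset P. Proof. by case/and3P: P_part. Qed.

Let mem_cover (i : 'I_n) : i \in cover P.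
Proof. by case/and3P: P_part => /eqP -> _ _; rewrite inE. Qed.

Lemma block_of_mem (i : 'I_n) : pblock P i \in P.
Proof. exact/pblock_mem/mem_cover. Qed.

Lemma mem_block_of (i : 'I_n) : i \in pblock P i.
Proof. by rewrite mem_pblock; apply: mem_cover. Qed.

Lemma block_ofE (B : {set 'I_n}) i : B \in P -> (pblock P i == B) = (i \in B).
Proof.
move=> PB; apply/eqP/idP => [<-|]; first exact: mem_block_of.
exact: def_pblock.
Qed.

Lemma block_nonempty (B : {set 'I_n}) : B \in P -> exists i, i \in B.
Proof.
move=> PB; apply/set0Pn; case/and3P: P_part => _ _; apply: contraNneq => <- //.
Qed.

Lemma noncrossingPn : reflect
  (exists i j i' j' : 'I_n, [/\ (i < j)%N, (j < i')%N & (i' < j')%N] /\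
     [/\ pblock P i = pblock P i', pblock P j = pblock P j' &
         pblock P i != pblock P j])
  (~~ noncrossing P).
Proof.
apply: (iffP idP) => [|[i [j [i' [j' [[ij ji' ij'] [Ei Ej Eij]]]]]]].
  rewrite negb_forall_in => /exists_inP[B PB].
  rewrite negb_forall_in => /exists_inP[B' PB'].
  rewrite negb_imply negbK => /andP[nBB'].
  case/exists_inP => i Bi /exists_inP[j Bj] /exists_inP[i' Bi'].
  case/exists_inP => j' Bj' /and3P[ij ji' ij'].
  exists i, j, i', j'; split=> //.
  by move: Bi Bj Bi' Bj'; rewrite -!block_ofE // => /eqP-> /eqP-> /eqP-> /eqP->.
rewrite negb_forall_in; apply/exists_inP; exists (pblock P i); first exact: block_of_mem.
rewrite negb_forall_in; apply/exists_inP; exists (pblock P j); first exact: block_of_mem.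
rewrite negb_imply negbK Eij.
apply/exists_inP; exists i; first exact: mem_block_of.
apply/exists_inP; exists j; first exact: mem_block_of.
apply/exists_inP; exists i'; first by rewrite Ei mem_block_of.
apply/exists_inP; exists j'; first by rewrite Ej mem_block_of.
exact/and3P.
Qed.

Lemma noncrossing_ltn (i j i' j' : 'I_n) : noncrossing P ->
  (i < j)%N -> (j < i')%N -> pblock P i = pblock P i' ->
  pblock P j = pblock P j' -> pblock P i != pblock P j -> (j' < i')%N.
Proof.
move=> nc ij ji' Ei Ej Eij; case: (ltngtP j' i') => // [ij'|e].
  suff: ~~ noncrossing P by rewrite nc.
  by apply/noncrossingPn; exists i, j, i', j'.
by rewrite Ei Ej -(ord_inj e) eqxx in Eij.
Qed.

Lemma noncrossing_gtn (i j i' j' : 'I_n) : noncrossing P ->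
  (i < j)%N -> (j < i')%N -> pblock P i = pblock P i' ->
  pblock P j = pblock P j' -> pblock P i != pblock P j -> (i < j')%N.
Proof.
move=> nc ij ji' Ei Ej Eij; case: (ltngtP i j') => // [ij'|e].
  suff: ~~ noncrossing P by rewrite nc.
  apply/noncrossingPn; exists j', i, j, i'; split=> //; split=> //.
  by rewrite -Ej eq_sym.
by rewrite Ej -(ord_inj e) eqxx in Eij.
Qed.

Lemma covers_block (i j j' : 'I_n) : noncrossing P ->
  pblock P j = pblock P j' -> covers i j -> covers i j'.
Proof.
move=> nc Ej /and3P[ij nij /existsP[k /andP[jk /eqP Ek]]].
apply/and3P; split; last (apply/existsP; exists k; rewrite Ek eqxx andbT).
- by apply: (noncrossing_gtn nc ij jk _ Ej).
- by rewrite -Ej.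
- by apply: (noncrossing_ltn nc ij jk _ Ej).
Qed.

Lemma bmin_le (B : {set 'I_n}) i : i \in B -> (bmin B <= i)%N.
Proof.
move=> Bi; rewrite /bmin; have := mem_index_enum i.
elim: (index_enum _) => // j r IH; rewrite inE big_cons => /orP[/eqP<-|/IH le].
  by rewrite Bi geq_minl.
by case: ifP => // _; rewrite geq_min le orbT.
Qed.

Lemma bmin_mem (B : {set 'I_n}) : B != set0 -> exists2 i, i \in B & bmin B = i.
Proof.
case/set0Pn => i0 Bi0; case: (arg_minnP (fun i : 'I_n => i : nat) Bi0) => i Bi le.
exists i => //; apply/eqP; rewrite eqn_leq bmin_le //=.
rewrite /bmin; elim/big_ind: _ => [|a b ia ib|j Bj]; [exact: ltnW| |exact: le].
by rewrite leq_min ia ib.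
Qed.

Lemma bmax_ge (B : {set 'I_n}) i : i \in B -> (i <= bmax B)%N.
Proof. by move=> Bi; rewrite /bmax (bigD1 i) //= leq_maxl. Qed.

Lemma bmax_mem (B : {set 'I_n}) : B != set0 -> exists2 i, i \in B & bmax B = i.
Proof.
case/set0Pn => i0 Bi0; case: (arg_maxnP (fun i : 'I_n => i : nat) Bi0) => i Bi le.
exists i => //; apply/eqP; rewrite eqn_leq bmax_ge // andbT.
by apply/bigmax_leqP => j; apply: le.
Qed.

Let block_neq0 i : pblock P i != set0.
Proof. by apply/set0Pn; exists i; apply: mem_block_of. Qed.

Lemma nested_covers (i j : 'I_n) : nested (pblock P i) (pblock P j) ->
  exists2 i', pblock P i' = pblock P i & covers i' j.
Proof.
case/and3P => lt1 _ lt2.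
have [a Pa Ea] := bmin_mem (block_neq0 i).
have [b Pb Eb] := bmax_mem (block_neq0 i).
have PEa := def_pblock tiP (block_of_mem i) Pa.
have PEb := def_pblock tiP (block_of_mem i) Pb.
have aj : (a < j)%N by rewrite -Ea (leq_trans lt1) ?bmin_le ?mem_block_of.
have jb : (j < b)%N by rewrite -Eb (leq_ltn_trans _ lt2) ?bmax_ge ?mem_block_of.
exists a => //; apply/and3P; split=> //.
  by rewrite PEa; apply: contraTneq lt1 => ->; rewrite ltnn.
by apply/existsP; exists b; rewrite jb PEa PEb eqxx.
Qed.

Lemma covers_nested (i j : 'I_n) : noncrossing P -> covers i j ->
  nested (pblock P i) (pblock P j).
Proof.
move=> nc /and3P[ij nij /existsP[k /andP[jk /eqP Ek]]].
have [a Pa Ea] := bmin_mem (block_neq0 j).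
have [b Pb Eb] := bmax_mem (block_neq0 j).
have PEa := def_pblock tiP (block_of_mem j) Pa.
have PEb := def_pblock tiP (block_of_mem j) Pb.
apply/and3P; split.
- rewrite Ea (leq_ltn_trans (bmin_le (mem_block_of i))) //.
  by apply: (noncrossing_gtn nc ij jk).
- by rewrite (leq_trans (bmin_le (mem_block_of j))) ?bmax_ge ?mem_block_of.
- rewrite Eb (leq_trans _ (@bmax_ge _ k _)) //; last by rewrite -Ek mem_block_of.
  by apply: (noncrossing_ltn nc ij jk).
Qed.

Definition next_level (K : 'I_n -> nat) (j : 'I_n) : nat :=
  \max_(i | covers i j) (K i).+1.

(** Recursion on positions: [next_level] at [j] only looks at smaller positions, so the value at [j]
    no longer changes after [j + 1] rounds and [n] rounds reach the fixed point. *)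
Definition level : 'I_n -> nat := iter n next_level (fun=> 0%N).

Lemma eq_next_level (K K' : 'I_n -> nat) (j : 'I_n) :
  (forall i : 'I_n, (i < j)%N -> K i = K' i) ->
  next_level K j = next_level K' j.
Proof. by move=> e; apply: eq_bigr => i /and3P[ij _ _]; rewrite e. Qed.

Lemma levelE j : level j = next_level level j.
Proof.
have stab t (i : 'I_n) : (i < t)%N ->
    iter t.+1 next_level (fun=> 0%N) i = iter t next_level (fun=> 0%N) i.
  elim: t i => // t IH i it; rewrite !iterS; apply: eq_next_level => k ki.
  by apply: IH; apply: leq_trans ki it.
by rewrite /level -[RHS]/(iter n.+1 next_level (fun=> 0%N) j) stab.
Qed.

Lemma level_unique (K : 'I_n -> nat) :
  (forall j, K j = next_level K j) -> K =1 level.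
Proof.
move=> eK j; have [t] := ubnP (j : nat); elim: t j => // t IH j jt.
rewrite eK levelE; apply: eq_next_level => i ij.
by apply: IH; apply: leq_trans ij jt.
Qed.

Lemma level_block i j : noncrossing P -> pblock P i = pblock P j ->
  level i = level j.
Proof.
move=> nc e; rewrite !levelE; apply: eq_bigl => k.
by apply/idP/idP; apply: covers_block.
Qed.

Lemma covers_level i j : covers i j -> (level i < level j)%N.
Proof. by move=> c; rewrite [level j]levelE /next_level (bigD1 i) //= leq_maxl. Qed.

Lemma level_ltn j : (level j < n)%N.
Proof.
suff le : (level j <= j)%N by apply: leq_ltn_trans le _.
have [t] := ubnP (j : nat); elim: t j => // t IH j jt.
rewrite levelE; apply/bigmax_leqP => i /and3P[ij _ _].
by apply: leq_ltn_trans (ij); apply: IH; apply: leq_trans ij jt.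
Qed.

(** Going from [j] to a covering position of maximal level lowers the level by exactly one; the
    blocks met on the way down to level 0 form the chain. *)
Lemma level_chain (j : 'I_n) : noncrossing P ->
  exists s : seq {set 'I_n}, [/\ size s = level j, all [in P] (rcons s (pblock P j))
    & sorted (@nested n) (rcons s (pblock P j))].
Proof.
move=> nc; have [t] := ubnP (j : nat); elim: t j => // t IH j jt.
have [i ci|no] := pickP (covers^~ j); last first.
  exists [::]; split=> //=; last by rewrite block_of_mem.
  by rewrite levelE /next_level big_pred0.
have [i' ci' e] : exists2 i', covers i' j & level j = (level i').+1.
  have c0 : (0 < #|[pred i | covers i j]|)%N by apply/card_gt0P; exists i.
  have [i' ci' e] := eq_bigmax_cond (fun i => (level i).+1) c0.
  by exists i' => //; rewrite levelE; apply: e.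
have [i't _ _] := and3P ci'.
have [|s [ss sP sn]] := IH i'; first by apply: leq_trans i't jt.
exists (rcons s (pblock P i')); split.
- by rewrite size_rcons ss.
- by rewrite all_rcons /= block_of_mem.
- move: sn; case: (s) => [|B s'] /=; first by rewrite covers_nested.
  by rewrite [path _ _ (rcons (rcons _ _) _)]rcons_path last_rcons covers_nested // andbT.
Qed.

(** Each nested pair raises the level by at least one, because the level is constant on blocks. *)
Lemma chain_level (s : seq {set 'I_n}) (j : 'I_n) : noncrossing P ->
  all [in P] (rcons s (pblock P j)) -> sorted (@nested n) (rcons s (pblock P j)) ->
  (size s <= level j)%N.
Proof.
move=> nc; elim/last_ind: s j => // s B IH j.
rewrite all_rcons => /andP[_ sP] sn.
have PB : B \in P by move: sP; rewrite all_rcons => /andP[].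
have [i Bi] := block_nonempty PB; move: (def_pblock tiP PB Bi) => eB; subst B.
have {sn} [sn /nested_covers[i' ei' /covers_level lt]] :
    sorted (@nested n) (rcons s (pblock P i)) /\ nested (pblock P i) (pblock P j).
  case: (s) sn => [|B s'] /=; first by rewrite andbT.
  by rewrite [path _ _ (rcons (rcons _ _) _)]rcons_path last_rcons => /andP[].
rewrite size_rcons (leq_trans _ lt) // ltnS (level_block nc ei').
exact: IH.
Qed.

Lemma depth_level m : noncrossing P -> (0 < n)%N ->
  (depth P <= m)%N = [forall j, level j < m]%N.
Proof.
move=> nc n0; apply/idP/forallP => [le j|lt].
  apply: leq_trans le; rewrite /depth.
  have [s [ss sP sn]] := level_chain j nc.
  have sz : size (rcons s (pblock P j)) == (level j).+1 by rewrite size_rcons ss.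
  have h : ((level j).+1 < n.+1)%N by rewrite ltnS level_ltn.
  rewrite (bigD1 (Ordinal h)) /= ?leq_maxl //.
  by apply/existsP; exists (Tuple sz); rewrite /= sP sn.
apply/bigmax_leqP => -[d dn] /= /existsP[[s /= /eqP ss]] /andP[sP sn].
elim/last_ind: s ss sP sn => [<- //|s B _ ss sP sn].
have PB : B \in P by move: sP; rewrite all_rcons => /andP[].
have [i Bi] := block_nonempty PB; move: (def_pblock tiP PB Bi) => eB; subst B.
by rewrite -ss size_rcons (leq_ltn_trans (chain_level nc sP sn)).
Qed.

(** The only coloring that can solve the recursion is [level]. A crossing i < j < i' < j' makes i
    cover j and j cover i', so the level would increase strictly inside one block. Without crossings
    [level] is constant on blocks, and it fits into [m] colors iff the depth is at most [m]. *)
Lemma card_level m : (0 < n)%N ->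
  #|[set k : {ffun 'I_n -> 'I_m} |
      [forall i, forall j, (pblock P i == pblock P j) ==> (k i == k j)]
      && [forall j, k j == next_level (fun i => k i) j :> nat]]| =
  noncrossing P && (depth P <= m)%N.
Proof.
move=> n0; have uniq (k : {ffun 'I_n -> 'I_m}) :
    [forall j, k j == next_level (fun i => k i) j :> nat] ->
    (fun i => k i : nat) =1 level.
  by move/forallP => h; apply: level_unique => j; apply/eqP.
have [nc|] := boolP (noncrossing P); last first.
  move/noncrossingPn => [i [j [i' [j' [[ij ji' ij'] [Ei Ej Eij]]]]]].
  apply: eq_card0 => k; rewrite inE; apply/negbTE/negP => /andP[/forallP kb /uniq kl].
  have c1 : covers i j.
    by rewrite /covers ij Eij; apply/existsP; exists i'; rewrite ji' Ei eqxx.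
  have c2 : covers j i'.
    by rewrite /covers ji' -Ei eq_sym Eij; apply/existsP; exists j'; rewrite ij' Ej eqxx.
  have := ltn_trans (covers_level c1) (covers_level c2); rewrite -!kl.
  have /forallP/(_ i')/implyP/(_ (introT eqP Ei))/eqP-> := kb i.
  by rewrite ltnn.
rewrite depth_level //=.
have [/forallP lt|/forallPn[j nlt]] := boolP [forall j, level j < m]%N.
  pose k := [ffun j => Ordinal (lt j)]; transitivity #|[set k]|; last by rewrite cards1.
  apply: eq_card => k'.
  rewrite !inE; apply/andP/eqP => [[_ /uniq kl]|->].
    by apply/ffunP => j; apply: val_inj; rewrite ffunE /= kl.
  split; apply/forallP => i.
    apply/forallP => j; apply/implyP => /eqP e; apply/eqP/val_inj.
    by rewrite !ffunE /= (level_block nc e).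
  rewrite ffunE /= levelE; apply/eqP; apply: eq_bigr => a _.
  by rewrite ffunE.
apply: eq_card0 => k; rewrite inE; apply/negbTE/negP => /andP[_ /uniq kl].
by rewrite -kl ltn_ord in nlt.
Qed.

End Levels.

(** * Runs of x's in the words at the sites *)

(** [None] stands for a unit at the site and disappears from the word. *)
Definition word_of_letters (s : seq (option bool)) : seq bool :=
  foldr (fun c w => if c is Some b then cons_letter b w else w) [::] s.

Definition nruns (w : seq bool) : nat := count (leq 1) (runs w).

Lemma nruns_cons_t w : nruns (cons_letter true w) = nruns w.
Proof. by rewrite /cons_letter; case: w => [|[] w]. Qed.

(** A new run starts unless [w] begins with x; the default [true] lets the empty word count as one
    that begins with t. *)
Lemma nruns_cons_x w : nruns (cons_letter false w) = (head true w + nruns w)%N.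
Proof.
rewrite /nruns /cons_letter; case: w => [|[] w] //=.
by case: (runs w).
Qed.

Section Letters.

Variables (n : nat) (c : 'I_n -> option bool).
Implicit Types (r : seq 'I_n) (i j k : 'I_n).

Let lt : rel 'I_n := fun i j => (i < j)%N.

(** Units disappear, so the first letter other than [None] decides: the word begins with x iff some
    x has no t before it. *)
Lemma head_word_of_letters r : sorted lt r ->
  head true (word_of_letters (map c r)) =
  all (fun k => (c k == Some false) ==>
         has (fun j => (j < k)%N && (c j == Some true)) r) r.
Proof.
elim: r => // i r IH ir; have lt_i : all (lt i) r.
  by apply: order_path_min ir => a b d; apply: ltn_trans.
have {IH} IH := IH (path_sorted ir).
have Hr j : j \in r -> (i < j)%N by move=> jr; exact: (allP lt_i).
rewrite /=; case ci: (c i) => [[]|] /=.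
- rewrite /cons_letter; transitivity true.
    by case: (word_of_letters _) => [|[] s].
  by apply/esym/allP => k kr; apply/implyP => _; rewrite Hr.
- rewrite andbF /=; apply/esym/negbTE; rewrite negb_and; apply/orP; left.
  by apply/hasPn => j jr; rewrite ltnNge ltnW // Hr.
- rewrite IH; apply: eq_in_all => k kr.
  by rewrite andbF.
Qed.

Definition ends_run r i : bool :=
  all (fun k => (i < k)%N ==> (c k == Some false) ==>
         has (fun j => (i < j < k)%N && (c j == Some true)) r) r.

(** Each run is counted at its last x, the one that is separated by a t from every later x. *)
Lemma nruns_letters r : sorted lt r ->
  nruns (word_of_letters (map c r)) =
  count (fun i => (c i == Some false) && ends_run r i) r.
Proof.
elim: r => // i r IH ir; have lt_i : all (lt i) r.
  by apply: order_path_min ir => a b d; apply: ltn_trans.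
have Hr j : j \in r -> (i < j)%N by move=> jr; exact: (allP lt_i).
(* An x put in front closes its own run iff the remaining word is empty or begins with t. *)
have er : ends_run (i :: r) i = head true (word_of_letters (map c r)).
  rewrite head_word_of_letters ?(path_sorted ir) // /ends_run /= ltnn /=.
  apply: eq_in_all => k kr; rewrite Hr //=; congr (_ ==> _).
  by apply: eq_in_has => j jr; rewrite Hr.
have E : count (fun i => (c i == Some false) && ends_run r i) r =
    count (fun j => (c j == Some false) && ends_run (i :: r) j) r.
  apply: eq_in_count => j jr; congr (_ && _); rewrite /ends_run /=.
  have ji : (j < i)%N = false by rewrite ltnNge ltnW // Hr.
  by rewrite ji; apply: eq_in_all => k kr.
rewrite [RHS]/= -E -(IH (path_sorted ir)) er /=.
case: (c i) => [[]|] //=; first exact: nruns_cons_t.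
exact: nruns_cons_x.
Qed.

Lemma ends_run_enum i : ends_run (enum 'I_n) i =
  [forall k : 'I_n, (i < k)%N ==> (c k == Some false) ==>
     [exists j : 'I_n, (i < j < k)%N && (c j == Some true)]].
Proof.
have hasE (p : pred 'I_n) : has p (enum 'I_n) = [exists j, p j].
  apply/hasP/existsP => [[j _ pj]|[j pj]]; first by exists j.
  by exists j; rewrite ?mem_enum.
rewrite /ends_run; apply/allP/forallP => [h k|h k _].
  by rewrite -hasE; apply: h; rewrite mem_enum.
by rewrite hasE.
Qed.

End Letters.

(* The letter at the site (a, k) of the i-th factor of a product of simple
   tensors x_(l_i, kap_i) (x) t: here [B] is the set of the i with l_i = a, and
   [eps i] tells gamma_hat from gamma. *)
Definition letter n (kap : 'I_n -> nat) (eps : 'I_n -> bool) (B : {set 'I_n})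
    (k : nat) (i : 'I_n) : option bool :=
  if i \in B then if kap i == k then Some false else None
  else if (kap i - eps i <= k)%N then Some true else None.

Definition site_word n kap eps (B : {set 'I_n}) (k : nat) : seq bool :=
  word_of_letters [seq letter kap eps B k i | i <- enum 'I_n].

Section RunCount.

Variables (n m : nat) (P : {set {set 'I_n}}).
Hypothesis P_part : partition P [set: 'I_n].
Variables (kap : {ffun 'I_n -> 'I_m}) (eps : 'I_n -> bool).

Let kapn : 'I_n -> nat := fun i => kap i.

Let same (i j : 'I_n) := pblock P i == pblock P j.

(** The number of moments in the value of a term, hence its order of decay as a power of 1/N. *)
Definition total_runs : nat :=
  (\sum_(B in P) \sum_(k < m) nruns (site_word kapn eps B k))%N.

(** Position [i] carries an x only at the site given by its block and its color; the run in question
    is the one at that site. *)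
Definition run_end (i : 'I_n) : bool :=
  [forall k : 'I_n, (i < k)%N ==> same k i ==> (kap k == kap i) ==>
    [exists j : 'I_n, (i < j < k)%N && ~~ same j i && (kap j - eps j <= kap i)%N]].

Lemma total_runsE : total_runs = #|[set i | run_end i]|.
Proof.
have E B (k : 'I_m) : B \in P -> nruns (site_word kapn eps B k) =
    (\sum_(i : 'I_n | (pblock P i == B) && (kap i == k)) run_end i)%N.
  move=> PB; rewrite /site_word nruns_letters; last first.
    by have := iota_ltn_sorted 0 n; rewrite -val_enum_ord sorted_map.
  rewrite -sum1_count big_enum_cond /= big_mkcond [RHS]big_mkcond /=.
  apply: eq_bigr => i _; rewrite (block_ofE P_part) //.
  have -> : (letter kapn eps B k i == Some false) = (i \in B) && (kap i == k).
    by rewrite /letter /kapn; case: (i \in B); case: eqVneq => //; case: ifP.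
  have [/andP[iB /eqP ki]|//] := boolP ((i \in B) && (kap i == k)); rewrite andTb.
  have PB' : pblock P i = B by apply/eqP; rewrite (block_ofE P_part).
  suff -> : ends_run (letter kapn eps B k) (enum 'I_n) i = run_end i by case: (run_end i).
  rewrite ends_run_enum /run_end; apply: eq_forallb => j.
  have -> : (letter kapn eps B k j == Some false) = same j i && (kap j == kap i).
    rewrite /same PB' (block_ofE P_part) // /letter /kapn -ki.
    by rewrite -val_eqE; case: (j \in B); case: eqVneq => //; case: ifP.
  case: (i < j)%N => //=; case: (same j i) => //=; case: (kap j == kap i) => //=.
  apply: eq_existsb => a; rewrite /letter /same PB' (block_ofE P_part) // /kapn -ki.
  by case: (a \in B); case: ifP; rewrite /= ?andbF ?andbT.
rewrite /total_runs -sum1_card.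
under eq_bigr => B PB do under eq_bigr => k _ do rewrite E //.
rewrite (partition_big (fun i => pblock P i) (mem P)) /=; last first.
  by move=> i _; apply: block_of_mem.
apply: eq_bigr => B PB; rewrite (partition_big kap predT) //=; apply: eq_bigr => k _.
rewrite big_mkcond [RHS]big_mkcond; apply: eq_bigr => i _.
by rewrite inE -andbA; case: (run_end i); case: (_ && _).
Qed.

(** The lowest color at which [j] puts a t is [kap j - eps j], so the second condition keeps every t
    away from between two points of a block at their site. Truncation for gamma_hat at color 0 is
    harmless, since [gsign] vanishes there. *)
Definition compatible : bool :=
  [forall i, forall j, same i j ==> (kap i == kap j)] &&
  [forall j, forall i, covers P i j ==> (kap i < kap j - eps j)%N].

Let is_last (i : 'I_n) : bool := [forall k : 'I_n, (i < k)%N ==> ~~ same k i].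

Let last_run_end : [set i | is_last i] \subset [set i | run_end i].
Proof.
apply/fintype.subsetP => i; rewrite !inE => /forallP li.
apply/forallP => k; apply/implyP => ik.
by have /implyP/(_ ik)/negbTE -> := li k.
Qed.

Let is_last_uniq i j : is_last i -> is_last j -> same i j -> i = j.
Proof.
move=> /forallP li /forallP lj ij; apply: val_inj; case: (ltngtP i j) => // h.
  by have /implyP/(_ h) := li j; rewrite /same eq_sym (eqP ij) eqxx.
by have /implyP/(_ h) := lj i; rewrite ij.
Qed.

Let card_last : #|[set i | is_last i]| = #|P|.
Proof.
rewrite -(card_in_imset (f := fun i => pblock P i)); last first.
  by move=> i j; rewrite !inE => li lj /eqP; apply: is_last_uniq.
apply: eq_card => B; apply/imsetP/idP => [[i _ ->]|PB]; first exact: block_of_mem.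
have [i0 Bi0] := block_nonempty P_part PB.
case: (arg_maxnP (fun i : 'I_n => i : nat) Bi0) => i Bi le.
exists i; last by apply/esym/eqP; rewrite (block_ofE P_part).
rewrite inE; apply/forallP => k; apply/implyP => ik; apply: contraTN ik.
rewrite /same -leqNgt => /eqP e; apply: le.
by change (is_true (k \in B)); rewrite -(block_ofE P_part) // e (block_ofE P_part).
Qed.

(** The last point of each block has no later x at its site and thus ends a run. *)
Lemma total_runs_ge : (#|P| <= total_runs)%N.
Proof. by rewrite total_runsE -card_last subset_leq_card. Qed.

(** Equality means that every run ends at the last point of its block, which excludes a second color
    in a block and a t between two of its points. *)
Lemma total_runs_eq : (total_runs == #|P|) = compatible.
Proof.
rewrite total_runsE -card_last eq_sym (subset_leqif_card last_run_end).
apply/fintype.subsetP/andP => [H|[/forallP kc /forallP cc] i]; last first.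
  rewrite !inE => /forallP ri; apply/forallP => k; apply/implyP => ik; apply/negP => ki.
  have /implyP/(_ ik)/implyP/(_ ki)/implyP := ri k.
  have /forallP/(_ i)/implyP/(_ ki) kk := kc k.
  move=> /(_ kk)/existsP[j /andP[/andP[/andP[ij jk] nji]]].
  have /forallP/(_ i)/implyP := cc j; rewrite ltnNge => h; apply/negP/h.
  by rewrite /covers ij eq_sym nji; apply/existsP; exists k; rewrite jk.
have {}H i : run_end i -> is_last i by move: (H i); rewrite !inE.
(* The last point of a given block and color ends a run, so it is the last point of the whole block;
   hence all colors in the block agree. *)
have lastP i : exists2 a, is_last a & same a i /\ kap a = kap i.
  have h0 : same i i && (kap i == kap i) by rewrite /same !eqxx.
  case: (arg_maxnP (P := fun a => same a i && (kap a == kap i))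
    (fun i : 'I_n => i : nat) h0) => a /andP[ai /eqP ka] le.
  exists a => //; apply: H; apply/forallP => k.
  apply/implyP => ik; apply/implyP => ki; apply/implyP => kk; move: ik.
  rewrite ltnNge => /negP; case; apply: le.
  by rewrite /same (eqP ki) (eqP kk) ka eqxx andbT.
have kc i j : same i j -> kap i = kap j.
  have [[a la [ai <-]] [b lb [bj <-]]] := (lastP i, lastP j).
  move=> ij; congr (kap _); apply: is_last_uniq => //.
  by rewrite /same (eqP ai) (eqP ij) eq_sym.
split; apply/forallP => j; apply/forallP => i; apply/implyP; first by move/kc => ->.
case/and3P=> ij nij /existsP[k /andP[jk ki]].
have h0 : same i i && (i < j)%N by rewrite /same eqxx.
(* Let [a] be the last point before [j] in the covering block. Were the color of [j] too low, the t
   at [j] would separate [a] from all later points of the block and end a run at [a], although the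
   block goes on past [j]. *)
case: (arg_maxnP (P := fun a => same a i && (a < j)%N) (fun i : 'I_n => i : nat) h0).
move=> a /andP[ai aj] le.
have nla : ~~ is_last a.
  apply/forallPn; exists k; rewrite negb_imply (ltn_trans aj jk) negbK.
  by rewrite /same (eqP ai).
apply: contraNT nla => h; apply/H/forallP => b.
apply/implyP => ab; apply/implyP => ba; apply/implyP => _; apply/existsP; exists j.
rewrite aj (kc _ _ ai) [(_ - _ <= _)%N]leqNgt h andbT.
rewrite [same j a]/same (eqP ai) eq_sym nij andbT /=.
case: (ltngtP j b) => // [bj|e].
  move: ab; rewrite ltnNge => /negP; case; apply: le.
  by rewrite bj /same (eqP ba) (eqP ai) eqxx.
by move: nij; rewrite (ord_inj e) (eqP ba) (eqP ai) eqxx.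
Qed.

End RunCount.
(** * The signed count of colorings and the number of labellings *)

Local Open Scope ring_scope.

(* The coefficient of gamma ([e = false]) or gamma_hat ([e = true]) in j_(l,k);
   gamma_hat_k vanishes for the lowest k. *)
Definition gsign (A : nzRingType) (k : nat) (e : bool) : A :=
  if e then - (0 < k)%N%:R else 1.

(* Summing over gamma and gamma_hat at the position j, whose block has color
   k_j, gives [h <= k_j] - [h < k_j] = [k_j = h] with h the next level above
   the blocks that cover j. *)
Lemma sum_gsign_compatible (A : comNzRingType) n m (P : {set {set 'I_n}}) :
  partition P [set: 'I_n] -> (0 < n)%N ->
  \sum_(k : {ffun 'I_n -> 'I_m}) \sum_(e : {ffun 'I_n -> bool})
     (\prod_i gsign A (k i) (e i)) * (compatible P k e)%:R =
  (noncrossing P && (depth P <= m)%N)%:R.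
Proof.
move=> P_part n0; rewrite -(card_level P_part m n0) -sum1_card natr_sum.
rewrite [RHS]big_mkcond /=.
under [RHS]eq_bigr => k _ do rewrite inE.
apply: eq_bigr => k _.
rewrite /compatible; case: [forall i, _] => /=; last first.
  by rewrite big1 // => e _; rewrite mulr0.
(* For fixed [k] the condition is a conjunction over [j] whose j-th part involves only [e j]; the
   sum over [e] thus becomes a product of sums of two terms. *)
have E (e : {ffun 'I_n -> bool}) :
   (\prod_i gsign A (k i) (e i)) *
     [forall j, forall i, covers P i j ==> (k i < k j - e j)%N]%:R =
   \prod_j (gsign A (k j) (e j) * [forall i, covers P i j ==> (k i < k j - e j)%N]%:R).
  rewrite big_split /=; congr (_ * _); symmetry.
  case: (boolP [forall j, _]) => [/forallP h|/forallPn[j nh]].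
    by rewrite big1 // => j _; rewrite h.
  by rewrite (bigD1 j) //= (negbTE nh) mul0r.
under eq_bigr => e _ do rewrite E.
rewrite -(bigA_distr_bigA (fun j (b : bool) => gsign A (k j) b *
  [forall i, covers P i j ==> (k i < k j - b)%N]%:R)) /=.
have F j : \sum_(b : bool) gsign A (k j) b *
    [forall i, covers P i j ==> (k i < k j - b)%N]%:R =
    (k j == next_level P (fun i => k i) j :> nat)%:R.
  have G x : [forall i, covers P i j ==> (k i < x)%N] =
      (next_level P (fun i => k i) j <= x)%N.
    by apply/forallP/bigmax_leqP => h i; [move/(implyP (h i))|apply/implyP/h].
  (* At color 0 the gamma_hat term has coefficient 0, and h <= 0 means h = 0. *)
  rewrite big_bool /= !G; set h := next_level _ _ _; case: (nat_of_ord (k j)) => [|x].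
    by rewrite oppr0 mul0r add0r mul1r subn0 eq_sym leqn0.
  rewrite subn1 subn0 mulN1r mul1r /= [(h <= x.+1)%N]leq_eqVlt ltnS eq_sym.
  by case: eqVneq => [<-|_]; rewrite ?ltnn ?oppr0 ?add0r ?addNr.
under eq_bigr => j _ do rewrite F.
case: (boolP [forall j, _]) => [/forallP h|/forallPn[j nh]].
  by rewrite big1 // => j _; rewrite h.
by rewrite (bigD1 j) //= (negbTE nh) mul0r.
Qed.

Lemma preim_partitionE n (T : finType) (l : {ffun 'I_n -> T}) :
  preim_partition l [set: 'I_n] = [set [set j | l j == a] | a in l @: [set: 'I_n]].
Proof.
rewrite /preim_partition /equivalence_partition -imset_comp; apply: eq_in_imset => i _ /=.
by apply/setP => j; rewrite !inE eq_sym.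
Qed.

(** Labellings with kernel [P] correspond under [lift] to injections from the set of blocks into the
    labels. *)
Lemma card_preim_partition n (T : finType) (P : {set {set 'I_n}}) :
  partition P [set: 'I_n] ->
  #|[set l : {ffun 'I_n -> T} | preim_partition l [set: 'I_n] == P]| =
  (#|T| ^_ #|P|)%N.
Proof.
move=> P_part; have <- : #|{: {B | B \in P}}| = #|P| by rewrite card_sig.
pose block i : {B | B \in P} := exist _ (pblock P i) (block_of_mem P_part i).
have blockE (B : {B | B \in P}) i : (block i == B) = (i \in val B).
  by rewrite -val_eqE /= (block_ofE P_part) // (valP B).
pose pick (B : {B | B \in P}) := xchoose (block_nonempty P_part (valP B)).
have pickK B : block (pick B) = B.
  by apply/eqP; rewrite blockE /pick; apply: (xchooseP (block_nonempty P_part (valP B))).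
pose lift (g : {ffun {B | B \in P} -> T}) : {ffun 'I_n -> T} := [ffun i => g (block i)].
have lift_inj : injective lift.
  move=> g g' /ffunP e; apply/ffunP => B.
  by have := e (pick B); rewrite !ffunE pickK.
rewrite -card_inj_ffuns -(card_imset _ lift_inj); apply: eq_card => l; rewrite inE.
apply/eqP/imsetP => [e|[g]].
  have sameE i j : (block i == block j) = (l i == l j).
    rewrite blockE /= -(block_ofE P_part) ?block_of_mem // eq_sym.
    rewrite block_ofE ?block_of_mem //.
    suff -> : pblock P i = [set j | l j == l i] by rewrite inE eq_sym.
    case/and3P: (P_part) => _ tiP _; apply: def_pblock => //; last by rewrite inE.
    by rewrite -e preim_partitionE; apply: imset_f; apply: imset_f.
  exists [ffun B => l (pick B)].
    rewrite inE; apply/injectiveP => B B'; rewrite !ffunE => /eqP.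
    by rewrite -sameE !pickK => /eqP.
  apply/ffunP => i; rewrite !ffunE; apply/eqP.
  by rewrite -sameE pickK.
rewrite inE => /injectiveP g_inj ->; apply/setP => B.
rewrite preim_partitionE; apply/imsetP/idP => [[a /imsetP[i _ ->]] ->|PB].
  suff -> : [set j | lift g j == lift g i] = pblock P i by apply: block_of_mem.
  apply/setP => j; rewrite inE !ffunE (inj_eq g_inj).
  by rewrite -val_eqE /= (block_ofE P_part) ?block_of_mem.
have [i iB] := block_nonempty P_part PB.
exists (lift g i); first exact: imset_f.
apply/setP => j; rewrite inE !ffunE (inj_eq g_inj) -val_eqE /=.
rewrite block_ofE ?block_of_mem //; case/and3P: (P_part) => _ tiP _.
by rewrite (def_pblock tiP PB iB).
Qed.

(** * Expansion of the moments *)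

Local Open Scope complex_scope.

Section Expansion.

Variables (R : realType) (phi : {scalar {poly R[i]}}).

(** [word_value] on bare sequences, so that it applies to [site_word] without a proof of
    reducedness. *)
Definition weight (w : seq bool) : R[i] :=
  \prod_(k <- runs w | (0 < k)%N) phi 'X^k.

Lemma weight1 w : nruns w = 0%N -> weight w = 1.
Proof.
rewrite /nruns /weight => h; rewrite big_hasC // has_count.
by move: h => /= ->.
Qed.

Definition factor (l k : nat) (e : bool) : tword :=
  twordM (single (l, k) (xpow 1))
         (tset (fun s => (s.1 != l) && (k - e <= s.2)%N)).

Lemma incl_X : incl ('X : {poly R[i]}) = << xpow 1 >>.
Proof.
by rewrite /incl size_polyX big_ord_recl big_ord1 /= !coefX /= monalgU0 add0r.
Qed.

Lemma at_site_X s : at_site s (incl ('X : {poly R[i]})) = << single s (xpow 1) >>.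
Proof.
by rewrite /at_site incl_X msuppU1 big_seq_fset1 mcoeffUU.
Qed.

Lemma j_homE m l : j_hom m l ('X : {poly R[i]}) =
  \sum_(k < m) \sum_(e : bool) << gsign R[i] k e *g factor l k e >>.
Proof.
have UU f g : << f >> * << g >> = << twordM f g >> :> Btensor R.
  by rewrite malgM_def fgmulUU mul1r.
apply: eq_bigr => k _; rewrite /j_site big_bool /= addrC /gamma /gamma_hat.
rewrite at_site_X /t_on UU /factor subn0; congr (_ + _).
(* At the lowest color gamma_hat is 0, and so is its coefficient [gsign]. *)
case: (nat_of_ord k) => [|k']; first by rewrite !oppr0 monalgU0.
by rewrite UU subn1 /= monalgUN.
Qed.

Lemma prod_malgU (I : Type) (r : seq I) (c : I -> R[i]) (w : I -> tword) :
  \prod_(i <- r) << c i *g w i >> =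
  << \prod_(i <- r) c i *g foldr twordM tword1 (map w r) >> :> Btensor R.
Proof.
elim: r => [|i r IH]; first by rewrite !big_nil.
by rewrite !big_cons IH malgM_def fgmulUU.
Qed.

Lemma S_sum_expE m N n : S_sum R m N ^+ n =
  \sum_(l : {ffun 'I_n -> 'I_N}) \sum_(k : {ffun 'I_n -> 'I_m})
    \sum_(e : {ffun 'I_n -> bool})
    << \prod_i gsign R[i] (k i) (e i) *g
       foldr twordM tword1 [seq factor (l i) (k i) (e i) | i <- enum 'I_n] >>.
Proof.
rewrite -[n in LHS]card_ord -prodr_const.
rewrite (eq_bigr (fun=> \sum_(l < N) j_hom m l 'X)) //.
rewrite (bigA_distr_bigA (fun _ (l : 'I_N) => j_hom m l 'X)) /=.
apply: eq_bigr => l _.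
rewrite (eq_bigr (fun i => \sum_(k < m) \sum_(e : bool)
  << gsign R[i] k e *g factor (l i) k e >>)); last by move=> i _; apply: j_homE.
rewrite (bigA_distr_bigA (fun i (k : 'I_m) => \sum_(e : bool)
  << gsign R[i] k e *g factor (l i) k e >>)) /=.
apply: eq_bigr => k _.
rewrite (bigA_distr_bigA (fun i (e : bool) =>
  << gsign R[i] (k i) e *g factor (l i) (k i) e >>)) /=.
apply: eq_bigr => e _.
(* The product is noncommutative: the letters have to come in increasing order of positions. *)
have -> : index_enum 'I_n = enum 'I_n by rewrite /index_enum unlock enumT.
by rewrite (prod_malgU _ (fun i => gsign R[i] (k i) (e i))
  (fun i => factor (l i) (k i) (e i))).
Qed.

Section Word.

Variables (m N n : nat) (l : {ffun 'I_n -> 'I_N}) (k : {ffun 'I_n -> 'I_m}).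
Variable (e : {ffun 'I_n -> bool}).

Let W (r : seq 'I_n) : tword :=
  foldr twordM tword1 [seq factor (l i) (k i) (e i) | i <- r].

Lemma factors_word (a : 'I_N) (b : 'I_m) r : val (W r (a : nat, b : nat)) =
  word_of_letters [seq letter (fun i => k i) e [set i | l i == a] b i | i <- r].
Proof.
elim: r => // i r IH; rewrite /= -/(W r) IH /letter inE.
rewrite xpair_eqE /= -!val_eqE /= [(a : nat) == _]eq_sym [(b : nat) == _]eq_sym.
case: eqP => _ //=; first by case: eqP.
by case: ifP.
Qed.

(** No x occurs outside the finite grid of labels and colors, and products of 1 and t are again 1 or
    t. This reduces the product over all sites to a finite one. *)
Lemma factors_word_out (s : site) r :
  s \notin [seq (nat_of_ord a, nat_of_ord b) | a <- enum 'I_N, b <- enum 'I_m] ->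
  W r s = word1 \/ W r s = wt.
Proof.
case: s => a b sN; elim: r => [|i r IH]; first by left.
rewrite /= -/(W r); have -> : ((a, b) == (l i : nat, k i : nat)) = false.
  apply: contraNF sN => /eqP[-> ->].
  by apply: allpairs_f; rewrite mem_enum.
rewrite word1M; case: ifP => _; last by rewrite word1M.
by case: IH => ->; rewrite ?wordM1 ?wordMtt; right.
Qed.

Lemma tword_value_factors : tword_value phi (W (enum 'I_n)) =
  \prod_(a < N) \prod_(b < m)
    weight (site_word (fun i => k i) e [set i | l i == a] b).
Proof.
rewrite (@tword_value_seq _ _ _
  [seq (nat_of_ord a, nat_of_ord b) | a <- enum 'I_N, b <- enum 'I_m]).
- rewrite big_allpairs_dep big_enum; apply: eq_bigr => a _.
  rewrite big_enum; apply: eq_bigr => b _.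
  by rewrite /word_value factors_word.
- apply: allpairs_uniq; rewrite ?enum_uniq // => -[a b] [a' b'] _ _ /=.
  by case=> /ord_inj -> /ord_inj ->.
- by move=> s; apply: factors_word_out.
Qed.

End Word.

Lemma weight_site_set0 n m (k : {ffun 'I_n -> 'I_m}) (e : {ffun 'I_n -> bool}) b :
  weight (site_word (fun i => k i) e set0 b) = 1.
Proof.
apply: weight1; rewrite nruns_letters; last first.
  by have := iota_ltn_sorted 0 n; rewrite -val_enum_ord sorted_map.
apply/eqP; rewrite eqn0Ngt -has_count; apply/hasPn => i _.
by rewrite /letter inE; case: ifP.
Qed.

(* Labels that no letter carries contribute the factor 1. *)
Lemma prod_labels m N n (l : {ffun 'I_n -> 'I_N}) (k : {ffun 'I_n -> 'I_m})
    (e : {ffun 'I_n -> bool}) :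
  \prod_(a < N) \prod_(b < m)
    weight (site_word (fun i => k i) e [set i | l i == a] b) =
  \prod_(B in preim_partition l [set: 'I_n]) \prod_(b < m)
    weight (site_word (fun i => k i) e B b).
Proof.
rewrite preim_partitionE big_imset /=; last first.
  move=> a a' /imsetP[i _ ->] /imsetP[i' _ ->] /setP/(_ i).
  by rewrite !inE eqxx => /esym/eqP.
rewrite [RHS]big_mkcond; apply: eq_bigr => a _; case: ifPn => // na.
rewrite big1 // => b _; rewrite -[RHS](weight_site_set0 k e b).
suff -> : [set i | l i == a] = set0 by [].
apply/setP => i; rewrite !inE; apply/negbTE; apply: contraNneq na => <-.
exact: imset_f.
Qed.

(** The contribution of a single labelling with kernel [P]; by [prod_labels] it depends on the
    kernel only. *)
Definition partition_value m n (P : {set {set 'I_n}}) : R[i] :=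
  \sum_(k : {ffun 'I_n -> 'I_m}) \sum_(e : {ffun 'I_n -> bool})
    (\prod_i gsign R[i] (k i) (e i)) *
    \prod_(B in P) \prod_(b < m) weight (site_word (fun i => k i) e B b).

Lemma product_state_S_sum m N n : product_state phi (S_sum R m N ^+ n) =
  \sum_(P : {set {set 'I_n}} | partition P [set: 'I_n])
    (N ^_ #|P|)%:R * partition_value m P.
Proof.
rewrite S_sum_expE /product_state raddf_sum.
rewrite (partition_big (fun l : {ffun 'I_n -> 'I_N} => preim_partition l [set: 'I_n])
  (fun P => partition P [set: 'I_n])) /=; last first.
  by move=> l _; apply: preim_partitionP.
apply: eq_bigr => P P_part.
have := card_preim_partition 'I_N P_part; rewrite card_ord => <-.
rewrite -sum1_card natr_sum mulr_suml; apply: eq_big => [l|l /eqP <-]; first by rewrite inE.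
rewrite mul1r raddf_sum; apply: eq_bigr => k _; rewrite raddf_sum; apply: eq_bigr => e _.
by rewrite /= mmapU /= tword_value_factors prod_labels.
Qed.

End Expansion.

(** * The limit *)

Section Tends.

Local Open Scope classical_set_scope.

(** The limit is taken in [K^o], that is, in [K] as a normed module over itself; the wrapper keeps
    this choice out of the statements below. *)
Variant tends (K : numFieldType) (u : nat -> K) (x : K) : Prop :=
  Tends of u N @[N --> \oo] --> (x : K^o).

Variable K : numFieldType.
Implicit Types (u v : nat -> K) (x y : K).

Lemma tends_cst x : tends (fun=> x) x.
Proof. by constructor; apply: (@cvg_cst K^o). Qed.

Lemma tendsM u v x y : tends u x -> tends v y -> tends (fun N => u N * v N) (x * y).
Proof. by move=> [ux] [vy]; constructor; apply: cvgM. Qed.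

Lemma tendsD u v x y : tends u x -> tends v y -> tends (fun N => u N + v N) (x + y).
Proof. by move=> [ux] [vy]; constructor; apply: (@cvgD _ K^o). Qed.

Lemma tends_near u v x : tends u x ->
  (exists N0, forall N, (N0 < N)%N -> u N = v N) -> tends v x.
Proof.
move=> [ux] [N0 uv]; constructor; apply: cvg_trans ux; apply: near_eq_cvg; near=> N.
by apply: uv; near: N; exact: nbhs_infty_gt.
Unshelve. all: by end_near. Qed.

Lemma tends_sum (I : Type) (r : seq I) (Q : pred I) (u : I -> nat -> K) (x : I -> K) :
  (forall i, Q i -> tends (u i) (x i)) ->
  tends (fun N => \sum_(i <- r | Q i) u i N) (\sum_(i <- r | Q i) x i).
Proof.
move=> h; elim: r => [|i r IH].
  by rewrite big_nil; apply: (tends_near (tends_cst (0 : K))); exists 0%N => N _; rewrite big_nil.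
rewrite big_cons; case: ifP => Qi.
  apply: (tends_near (tendsD (h _ Qi) IH)).
  by exists 0%N => N _; rewrite big_cons Qi.
by apply: (tends_near IH); exists 0%N => N _; rewrite big_cons Qi.
Qed.

Lemma tends_prod (I : Type) (r : seq I) (Q : pred I) (u : I -> nat -> K) (x : I -> K) :
  (forall i, Q i -> tends (u i) (x i)) ->
  tends (fun N => \prod_(i <- r | Q i) u i N) (\prod_(i <- r | Q i) x i).
Proof.
move=> h; elim: r => [|i r IH].
  by rewrite big_nil; apply: (tends_near (tends_cst 1)); exists 0%N => N _; rewrite big_nil.
rewrite big_cons; case: ifP => Qi.
  apply: (tends_near (tendsM (h _ Qi) IH)).
  by exists 0%N => N _; rewrite big_cons Qi.
by apply: (tends_near IH); exists 0%N => N _; rewrite big_cons Qi.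
Qed.

Lemma tendsX u x p : tends u x -> tends (fun N => u N ^+ p) (x ^+ p).
Proof.
move=> ux; elim: p => [|p IH].
  by apply: (tends_near (tends_cst (1 : K))); exists 0%N.
by rewrite exprS; apply: (tends_near (tendsM ux IH)); exists 0%N => N _; rewrite exprS.
Qed.

(** Passing from q to q + 1 multiplies by (N - q) / N = 1 - q / N, where N > q makes the subtraction
    of naturals exact. *)
Lemma tends_ffact q : tends (fun N => N%:R^-1) (0 : K) ->
  tends (fun N => (N ^_ q)%:R * N%:R^-1 ^+ q) (1 : K).
Proof.
move=> natV; elim: q => [|q IH].
  by apply: (tends_near (tends_cst 1)); exists 0%N => N _; rewrite ffactn0 mulr1.
have := tendsM IH (tendsD (tends_cst 1) (tendsM (tends_cst (- q%:R)) natV)).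
rewrite mulr0 addr0 mulr1 => /tends_near; apply; exists q => N qN.
have N0 : (N%:R : K) != 0 by rewrite pnatr_eq0 -lt0n (leq_ltn_trans _ qN).
have -> : 1 + - q%:R * N%:R^-1 = (N - q)%:R * N%:R^-1 :> K.
  by rewrite natrB 1?ltnW // mulrBl mulfV // mulNr.
by rewrite ffactnSr natrM exprSr mulrACA.
Qed.

End Tends.

Lemma tends_natV (R : realType) : tends (fun N => N%:R^-1) (0 : R[i]).
Proof.
constructor; apply/(@cvgrPdist_lt _ R[i]^o) => eps eps_gt0.
(* A positive element of [R[i]] is real, so the comparison can be moved to [R]. *)
have -> : eps = (complex.Re eps)%:C.
  by move: eps_gt0; case: eps => a b; rewrite ltcE /= => /andP[/eqP -> _].
have e_gt0 : 0 < complex.Re eps by move: eps_gt0; rewrite ltcE => /andP[].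
near=> N; rewrite sub0r normrN normfV normr_nat.
have N_gt : (Num.truncn (complex.Re eps)^-1 < N)%N by near: N; exact: nbhs_infty_gt.
rewrite -[N%:R](rmorph_nat (real_complex R)) -fmorphV ltcR.
rewrite -[ltRHS]invrK ltf_pV2 ?posrE ?invr_gt0 ?ltr0n ?(leq_ltn_trans _ N_gt) //.
by apply: lt_le_trans (truncnS_gt _) _; rewrite ler_nat.
Unshelve. all: by end_near. Qed.

Section Limit.

Variables (R : realType) (phi : nat -> {scalar {poly R[i]}}) (lambda : R[i]).
Hypothesis phi_lim : forall k : nat, (0 < k)%N ->
  tends (fun N => N%:R * phi N 'X^k) lambda.

Lemma tends_weight w :
  tends (fun N => N%:R ^+ nruns w * weight (phi N) w) (lambda ^+ nruns w).
Proof.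
rewrite /weight /nruns; elim: (runs w) => [|k s IH].
  by rewrite expr0; apply: (tends_near (tends_cst 1)); exists 0%N => N _; rewrite big_nil mulr1.
rewrite /=; case: (ltnP 0 k) => k0; last first.
  apply: (tends_near IH); by exists 0%N => N _; rewrite big_cons [(0 < k)%N]ltnNge k0.
rewrite add1n exprS; apply: (tends_near (tendsM (phi_lim k0) IH)).
by exists 0%N => N _; rewrite big_cons k0 exprS mulrACA.
Qed.

(** With r runs and q blocks, split off N^_q / N^q and (1 / N)^(r - q); what remains is N^r times
    the moments. The three factors tend to 1, 0^(r - q) and lambda^r, and 0^(r - q) is 1 exactly
    when r = q, that is, for compatible colors and choices. *)
Lemma tends_term n m (P : {set {set 'I_n}}) (k : {ffun 'I_n -> 'I_m})
    (e : {ffun 'I_n -> bool}) : partition P [set: 'I_n] ->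
  tends (fun N => (N ^_ #|P|)%:R * \prod_(B in P) \prod_(b < m)
     weight (phi N) (site_word (fun i => k i) e B b))
  ((compatible P k e)%:R * lambda ^+ #|P|).
Proof.
move=> P_part; set q := #|P|; set r := total_runs P k e.
have qr : (q <= r)%N := total_runs_ge P_part k e.
have -> : (compatible P k e)%:R * lambda ^+ q = 1 * 0 ^+ (r - q) * lambda ^+ r.
  rewrite mul1r expr0n subn_eq0 -(total_runs_eq P_part) -/r -/q.
  by case: (ltngtP r q) qr => [_|_|->] //; rewrite !mul0r.
have expr_r (x : R[i]) : x ^+ r =
    \prod_(B in P) \prod_(b < m) x ^+ nruns (site_word (fun i => k i) e B b).
  by rewrite /r /total_runs expr_sum; apply: eq_bigr => B _; rewrite expr_sum.
have term_r : tends (fun N => N%:R ^+ r * \prod_(B in P) \prod_(b < m)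
     weight (phi N) (site_word (fun i => k i) e B b)) (lambda ^+ r).
  rewrite expr_r; apply: tends_near.
    by apply: tends_prod => B _; apply: tends_prod => b _; apply: tends_weight.
  exists 0%N => N _; rewrite expr_r -big_split; apply: eq_bigr => B _ /=.
  by rewrite -big_split.
apply: (tends_near (tendsM (tendsM (tends_ffact q (tends_natV R))
  (tendsX (r - q) (tends_natV R))) term_r)).
exists 0%N => N N_gt0.
have N0 : (N%:R : R[i]) != 0 by rewrite pnatr_eq0 -lt0n.
rewrite -!mulrA; congr (_ * _).
by rewrite mulrA -exprD subnKC // mulrA -exprMn mulVf // expr1n mul1r.
Qed.

Lemma tends_partition_value n m (P : {set {set 'I_n}}) :
  partition P [set: 'I_n] -> (0 < n)%N ->
  tends (fun N => (N ^_ #|P|)%:R * partition_value (phi N) m P)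
    ((noncrossing P && (depth P <= m)%N)%:R * lambda ^+ #|P|).
Proof.
move=> P_part n_gt0; rewrite -(sum_gsign_compatible _ m P_part n_gt0).
rewrite mulr_suml; under eq_bigr => k _ do rewrite mulr_suml.
apply: (@tends_near R[i]).
  apply: tends_sum => k _; apply: tends_sum => e _; rewrite -mulrA.
  exact: tendsM (tends_cst _) (tends_term k e P_part).
exists 0%N => N _; rewrite mulr_sumr; apply: eq_bigr => k _.
by rewrite mulr_sumr; apply: eq_bigr => e _; rewrite mulrCA.
Qed.

End Limit.

Local Open Scope classical_set_scope.

(** After the exchange of sums each partition contributes only at q = [#|P|], which is in the range:
    [P] has a block because n > 0, and at most n blocks because they are nonempty. *)
Lemma sum_NC (A : nzRingType) (x : A) n m : (0 < n)%N ->
  \sum_(1 <= q < n.+1) x ^+ q * #|NC n q m|%:R =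
  \sum_(P : {set {set 'I_n}} | partition P [set: 'I_n])
    (noncrossing P && (depth P <= m)%N)%:R * x ^+ #|P|.
Proof.
move=> n_gt0.
under eq_bigr => q _ do rewrite -sum1_card natr_sum mulr_sumr big_mkcond /=.
rewrite exchange_big [RHS]big_mkcond; apply: eq_bigr => P _ /=.
under eq_bigr => q _ do rewrite inE mulr1.
case: ifP => [P_part|_]; last by rewrite big1.
case: (noncrossing P); last by rewrite mul0r big1.
case: (depth P <= m)%N; last by rewrite mul0r big1 // => q _; rewrite /= andbF.
have P_ge1 : (1 <= #|P|)%N.
  by apply/card_gt0P; exists (pblock P (Ordinal n_gt0)); apply: block_of_mem.
have P_le : (#|P| <= n)%N.
  rewrite -[n in leqRHS]card_ord -cardsT (card_partition P_part) -sum1_card.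
  by apply: leq_sum => B /(block_nonempty P_part)[i Bi]; apply/card_gt0P; exists i.
rewrite (bigD1_seq #|P|) ?iota_uniq ?mem_index_iota ?P_ge1 //= eqxx mul1r.
rewrite big1 ?addr0 // => q; rewrite eq_sym => /negbTE -> //.
Qed.

Theorem theorem6p1 (R : realType) (m : nat) (lambda : R)
    (phi : nat -> {scalar {poly R[i]}})
    (m_gt0 : (0 < m)%N) (lambda_gt0 : 0 < lambda)
    (phi_state : forall N : nat, (0 < N)%N -> is_state (phi N))
    (phi_lim : forall k : nat, (0 < k)%N ->
       N%:R * phi N 'X^k @[N --> \oo] --> (lambda%:C : R[i]^o))
    (n : nat) (n_gt0 : (0 < n)%N) :
  product_state (phi N) (S_sum R m N ^+ n) @[N --> \oo] -->
  ((\sum_(1 <= q < n.+1) lambda ^+ q * #|NC n q m|%:R)%:C : R[i]^o).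
Proof.
have phi_tends k : (0 < k)%N -> tends (fun N => N%:R * phi N 'X^k) lambda%:C.
  by move=> k0; constructor; apply: phi_lim.
suff [] : tends (fun N => product_state (phi N) (S_sum R m N ^+ n))
    (\sum_(1 <= q < n.+1) lambda ^+ q * #|NC n q m|%:R)%:C by [].
have -> : (\sum_(1 <= q < n.+1) lambda ^+ q * #|NC n q m|%:R)%:C =
    \sum_(1 <= q < n.+1) lambda%:C ^+ q * #|NC n q m|%:R.
  rewrite rmorph_sum; apply: eq_bigr => q _.
  by rewrite rmorphM rmorphXn rmorph_nat.
rewrite sum_NC //; apply: (@tends_near R[i]).
  apply: tends_sum => P P_part.
  exact: (tends_partition_value phi_tends m P_part n_gt0).
by exists 0%N => N _; rewrite product_state_S_sum.
Qed.
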